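(* Let $\mathcal G$ be a finite collection of subsets (groups) of $[K]$, let $t\ge1$ be an integer such that every arm $i\in[K]$ belongs to at most $t$ groups of $\mathcal G$, and let $(f_g)_{g\in\mathcal G}$ be group floors. Let $x\in\mathbb R_{\ge0}^K$ be a fractional block plan whose group totals satisfy $\sum_{i\in g}x_i\ge f_g+t$ for every $g\in\mathcal G$ and whose ceiling budget satisfies $\sum_i\lceil x_i\rceil\le C$, where $C$ is the number of rounds reserved for the mandatory phase of the block. Then Beck--Fiala null-space rounding outputs, in polynomial time, an integral allocation $n\in\mathbb Z_{\ge0}^K$ with $n_i\in\{\lfloor x_i\rfloor,\lceil x_i\rceil\}$ for every arm $i$ (hence $\sum_i\lfloor x_i\rfloor\le\sum_i n_i\le\sum_i\lceil x_i\rceil\le C$) and with $$\Bigl|\sum_{i\in g}(n_i-x_i)\Bigr|<t\qquad\text{for every }g\in\mathcal G,$$ independent of the group size and of $|\mathcal G|$. Consequently every group floor is met, $\sum_{i\in g}n_i\ge f_g$ for every $g\in\mathcal G$, within the reserved budget $C$.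
   Context: Beck--Fiala null-space rounding: write $x_i=\lfloor x_i\rfloor+\phi_i$ with $\phi_i\in[0,1)$ and initialize $y=\phi$. A coordinate is alive if $y_i\in(0,1)$ and frozen otherwise; a group is active if it contains more than $t$ alive coordinates. While some coordinate is alive, choose a nonzero vector $v$ supported on the alive coordinates with $\sum_{i\in g}v_i=0$ for every active group $g$, and move $y$ along $\pm v$ until some alive coordinate reaches $0$ or $1$, freezing it there. At termination $y\in\{0,1\}^K$ and the output is $n_i=\lfloor x_i\rfloor+y_i$. (The claim includes that this procedure is well defined and terminates in polynomial time.) *)

(* Defs.v *)
From mathcomp Require Import all_boot all_order all_algebra.
From mathcomp Require Import reals.

Set Implicit Arguments.
Unset Strict Implicit.
Unset Printing Implicit Defensive.

Import Order.TTheory GRing.Theory Num.Theory.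
Local Open Scope ring_scope.

Section BeckFiala.
Variables (R : realType) (K : nat) (G : {set {set 'I_K}}) (t : nat).
Implicit Types x y z v w : 'rV[R]_K.

Definition alive y : {set 'I_K} := [set i | 0 < y 0 i < 1].

Definition active y : {set {set 'I_K}} :=
  [set g in G | (t < #|g :&: alive y|)%N].

Definition direction y v : Prop :=
  [/\ v != 0,
      forall i, i \notin alive y -> v 0 i = 0
    & forall g, g \in active y -> \sum_(i in g) v 0 i = 0].

(* [z] is the first point of the ray from [y] along [w] at which some
   coordinate alive at [y] equals 0 or 1. *)
Definition move y w z : Prop :=
  exists a : R,
    [/\ 0 < a,
        forall b : R, 0 <= b < a -> alive y \subset alive (y + b *: w),
        exists2 i, i \in alive y & z 0 i = 0 \/ z 0 i = 1
      & z = y + a *: w].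

(* The procedure leaves open which direction and which sign is taken, so it is
   a relation between successive points. *)
Definition step y z : Prop :=
  exists2 v, direction y v & move y v z \/ move y (- v) z.

Definition frac_part x : 'rV[R]_K :=
  \row_i (x 0 i - (Num.floor (x 0 i))%:~R).

(* No separate record of frozen coordinates is needed: they are exactly the
   ones outside [alive], and a direction vanishes on them. *)
Inductive reach x : nat -> 'rV[R]_K -> Prop :=
| Reach0 : reach x 0 (frac_part x)
| ReachS k y z : reach x k y -> step y z -> reach x k.+1 z.

Definition outputs x (n : 'I_K -> nat) : Prop :=
  exists k y,
    [/\ reach x k y, alive y = set0
      & forall i, (n i)%:R = (Num.floor (x 0 i))%:~R + y 0 i].

End BeckFiala.

(* A uniform real random access machine.
  Programs are fixed finite objects, independent of the input, without real
  constants other than 0 and 1.  Natural-number registers serve as counters and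
  addresses and only support addition and truncated subtraction.  Reals live in
  named two-dimensional arrays and support the field operations and comparison;
  there is no rounding operation.  Assignments and tests cost one unit each:
  the expressions in a given program have bounded size, so charging their
  individual operations would only change the cost by a constant factor. *)

Inductive iexp : Type :=
| IConst of nat
| IReg of nat
| IAdd of iexp & iexp
| ISub of iexp & iexp.

Inductive rexp : Type :=
| RZero
| ROne
| RCell of nat & iexp & iexp
| RAdd of rexp & rexp
| RSub of rexp & rexp
| RMul of rexp & rexp
| RDiv of rexp & rexp.

Inductive bexp : Type :=
| BLeI of iexp & iexp
| BLeR of rexp & rexp
| BNot of bexp
| BAnd of bexp & bexp.

Inductive cmd : Type :=
| Skip
| SetI of nat & iexp
| SetR of nat & iexp & iexp & rexp
| Seq of cmd & cmd
| If of bexp & cmd & cmd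
| While of bexp & cmd.

Section Machine.
Variable R : realType.

Record state : Type := State {
  ireg : nat -> nat;
  rmem : nat -> nat -> nat -> R
}.

Fixpoint ieval (s : state) (e : iexp) : nat :=
  match e with
  | IConst n => n
  | IReg r => ireg s r
  | IAdd e1 e2 => (ieval s e1 + ieval s e2)%N
  | ISub e1 e2 => (ieval s e1 - ieval s e2)%N
  end.

(* Division by zero returns 0. *)
Fixpoint reval (s : state) (e : rexp) : R :=
  match e with
  | RZero => 0
  | ROne => 1
  | RCell a i j => rmem s a (ieval s i) (ieval s j)
  | RAdd e1 e2 => reval s e1 + reval s e2
  | RSub e1 e2 => reval s e1 - reval s e2
  | RMul e1 e2 => reval s e1 * reval s e2
  | RDiv e1 e2 => reval s e1 / reval s e2
  end.

Fixpoint beval (s : state) (e : bexp) : bool :=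
  match e with
  | BLeI e1 e2 => (ieval s e1 <= ieval s e2)%N
  | BLeR e1 e2 => reval s e1 <= reval s e2
  | BNot e1 => ~~ beval s e1
  | BAnd e1 e2 => beval s e1 && beval s e2
  end.

Definition set_ireg (s : state) (r n : nat) : state :=
  State (fun r' => if r' == r then n else ireg s r') (rmem s).

Definition set_rmem (s : state) (a i j : nat) (u : R) : state :=
  State (ireg s)
    (fun a' i' j' =>
       if [&& a' == a, i' == i & j' == j] then u else rmem s a' i' j').

(* [exec p s k s']: started in [s], the program [p] halts in [s'] after [k]
   units of time. *)
Inductive exec : cmd -> state -> nat -> state -> Prop :=
| ExecSkip s : exec Skip s 1 s
| ExecSetI s r e : exec (SetI r e) s 1 (set_ireg s r (ieval s e))
| ExecSetR s a i j e :
    exec (SetR a i j e) s 1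
      (set_rmem s a (ieval s i) (ieval s j) (reval s e))
| ExecSeq p q s s' s'' k l :
    exec p s k s' -> exec q s' l s'' -> exec (Seq p q) s (k + l) s''
| ExecIfT b p q s s' k :
    beval s b -> exec p s k s' -> exec (If b p q) s k.+1 s'
| ExecIfF b p q s s' k :
    ~~ beval s b -> exec q s k s' -> exec (If b p q) s k.+1 s'
| ExecWhileF b p s : ~~ beval s b -> exec (While b p) s 1 s
| ExecWhileT b p s s' s'' k l :
    beval s b -> exec p s k s' -> exec (While b p) s' l s'' ->
    exec (While b p) s (k + l).+1 s''.

Definition entry (K : nat) (F : 'I_K -> R) (i : nat) : R := oapp F 0 (insub i).

(* Registers 0, 1, 2 hold K, the number of groups and t.  Array 0 is the
   group-arm incidence matrix for the listing [gs] of the groups; row 0 of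
   array 1 holds x and row 0 of array 2 holds its integer parts, which field
   operations and comparisons cannot compute in a number of steps independent
   of the magnitude of x. *)
Definition input (K : nat) (gs : seq {set 'I_K}) (t : nat) (x : 'rV[R]_K) :
    state :=
  State
    (fun r =>
       match r with 0%N => K | 1%N => size gs | 2%N => t | _ => 0%N end)
    (fun a j i =>
       match a, j with
       | 0%N, _ => entry (fun i' : 'I_K => (i' \in nth set0 gs j)%:R) i
       | 1%N, 0%N => entry (fun i' : 'I_K => x 0 i') i
       | 2%N, 0%N => entry (fun i' : 'I_K => (Num.floor (x 0 i'))%:~R) i
       | _, _ => 0
       end).

(* The result is read off row 0 of array 3. *)
Definition result (K : nat) (s : state) (n : 'I_K -> nat) : Prop :=
  forall i : 'I_K, rmem s 3 0 i = (n i)%:R.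

End Machine.

(* Main.v *)
(** A null vector exists because the alive arms are covered at most [t] times
    by the active groups, each of which contains at least [t + 1] of them: there
    are fewer active groups than alive arms.  Every move freezes an arm, so there
    are at most [K] moves.  The sum of [y] over a group is preserved while the
    group is active; afterwards at most [t] of its coordinates still move, each
    by less than 1.

    A null vector is computed by elimination: start from the unit vectors of the
    alive arms and, for each active group, subtract multiples of a row with
    nonzero group sum so as to make all group sums vanish.  The pivot row becomes
    zero, and the unused rows keep an identity block, hence remain nonzero. *)

Require Import Defs.
From mathcomp Require Import all_boot all_order all_algebra.
From mathcomp Require Import reals.
From mathcomp Require Import zify ring lra.

Set Implicit Arguments.
Unset Strict Implicit.
Unset Printing Implicit Defensive.

Import Order.TTheory GRing.Theory Num.Theory.
Local Open Scope ring_scope.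


(** * Moves and group discrepancies *)

Section Walk.
Variables (R : realType) (K : nat) (G : {set {set 'I_K}}) (t : nat).
Implicit Types x y z v w : 'rV[R]_K.

Lemma frac_part_itv x i : 0 <= frac_part x 0 i < 1.
Proof.
rewrite mxE; have := floor_itv (x 0 i).
rewrite intrD => /andP[? ?]; apply/andP; split; lra.
Qed.

Lemma alive0_01 y i : 0 <= y 0 i <= 1 -> i \notin alive y -> y 0 i = 0 \/ y 0 i = 1.
Proof.
rewrite inE => /andP[y0 y1]; rewrite negb_and -!leNgt => /orP[yn|yp].
- by left; apply/eqP; rewrite eq_le yn.
- by right; apply/eqP; rewrite eq_le y1.
Qed.

(** The step length at which coordinate [i] reaches the end of [0,1] it is heading for: 0 if [v 0 i]
    is negative, 1 if it is positive. Only meaningful for [v 0 i != 0]. *)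
Definition ratio y v i : R :=
  if v 0 i <= 0 then - y 0 i / v 0 i else (1 - y 0 i) / v 0 i.

Lemma ratio_hit y v i : v 0 i != 0 ->
  y 0 i + ratio y v i * v 0 i = 0 \/ y 0 i + ratio y v i * v 0 i = 1.
Proof. by rewrite /ratio; case: ifP => _ v0; [left|right]; field. Qed.

(** Only the end towards which [v 0 i] points can be crossed; the other inequality persists for
    [b >= 0] because [y 0 i] starts strictly inside. *)
Lemma ratio_alive y v i b : i \in alive y -> v 0 i != 0 -> 0 <= b ->
  (0 < y 0 i + b * v 0 i < 1) = (b < ratio y v i).
Proof.
rewrite inE /ratio => /andP[y0 y1]; case: (ltgtP (v 0 i) 0) => // v0 _ b0.
- rewrite ltr_ndivlMr //; apply/andP/idP => [[]|]; first by lra.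
  by move=> h; split; [lra|nra].
- rewrite ltr_pdivlMr //; apply/andP/idP => [[]|]; first by lra.
  by move=> h; split; [nra|lra].
Qed.

Lemma ratio_gt0 y v i : i \in alive y -> v 0 i != 0 -> 0 < ratio y v i.
Proof.
move=> iy v0; rewrite -ratio_alive // mul0r addr0.
by move: iy; rewrite inE.
Qed.

(** No coordinate of the support reaches its end before the smallest ratio, and the minimiser
    reaches it exactly then. *)
Lemma move_min_ratio y v i :
  (forall j, j \notin alive y -> v 0 j = 0) -> v 0 i != 0 ->
  (forall j, v 0 j != 0 -> ratio y v i <= ratio y v j) ->
  move y v (y + ratio y v i *: v).
Proof.
move=> supp vi mini.
have alv j : v 0 j != 0 -> j \in alive y by apply: contra_neqT => /supp.
exists (ratio y v i); split => //.
- exact: ratio_gt0 (alv _ vi) vi.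
- move=> b /andP[b0 bi]; apply/subsetP => j jy; rewrite inE !mxE.
  have [vj|vj] := eqVneq (v 0 j) 0; first by rewrite vj mulr0 addr0; move: jy; rewrite inE.
  by rewrite ratio_alive // (lt_le_trans bi) // mini.
- by exists i; [exact: alv|rewrite !mxE; apply: ratio_hit].
Qed.

Lemma move_exists y v : v != 0 -> (forall j, j \notin alive y -> v 0 j = 0) ->
  exists z, move y v z.
Proof.
move=> v0 supp; have [i vi] : exists i, v 0 i != 0.
  apply/existsP; apply: contraNT v0 => /existsPn h; apply/eqP/rowP => i.
  by rewrite mxE; apply/eqP; move: (h i); rewrite negbK.
case: (@arg_minP _ _ _ i (fun j => v 0 j != 0) (ratio y v) vi) => j vj minj.
by exists (y + ratio y v j *: v); apply: move_min_ratio.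
Qed.

(** Lets the sign in [step] be absorbed into the direction, so that later arguments treat the plus
    sign only. *)
Lemma directionN y v : direction G t y v -> direction G t y (- v).
Proof.
case=> v0 supp eqs; split; first by rewrite oppr_eq0.
- by move=> i /supp; rewrite mxE => ->; rewrite oppr0.
- move=> g /eqs e; under eq_bigr do rewrite mxE.
  by rewrite sumrN e oppr0.
Qed.

Lemma stepP y z : step G t y z -> exists2 v, direction G t y v & move y v z.
Proof.
by case=> v dv [mv|mv]; [exists v|exists (- v) => //; apply: directionN].
Qed.

Lemma step_frozen y z i : step G t y z -> i \notin alive y -> z 0 i = y 0 i.
Proof.
case/stepP => v [_ supp _] [a [_ _ _ ->]] /supp.
by rewrite !mxE => ->; rewrite mulr0 addr0.
Qed.

Lemma step_sum y z g : step G t y z -> g \in active G t y ->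
  \sum_(i in g) z 0 i = \sum_(i in g) y 0 i.
Proof.
case/stepP => v [_ _ eqs] [a [_ _ _ ->]] /eqs e.
under eq_bigr do rewrite !mxE.
by rewrite big_split /= -mulr_sumr e mulr0 addr0.
Qed.

Lemma step_itv y z : step G t y z ->
  (forall i, 0 <= y 0 i <= 1) -> forall i, 0 <= z 0 i <= 1.
Proof.
move=> st y01 i; have [iy|/(step_frozen st) -> //] := boolP (i \in alive y).
case/stepP: st => v _ [a [a0 al _ ->]]; rewrite !mxE.
have [->|vi] := eqVneq (v 0 i) 0; first by rewrite mulr0 addr0.
(* Were [a] larger, the ratio would be an earlier point of the ray, where [move] demands that [i] be
   alive although it sits at an end of [0,1]. *)
have ari : a <= ratio y v i.
  rewrite leNgt; apply/negP => ra.
  have r0 := ratio_gt0 iy vi.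
  have /subsetP/(_ i iy) : alive y \subset alive (y + ratio y v i *: v).
    by apply: al; rewrite ra ltW.
  by rewrite inE !mxE ratio_alive ?ltxx // ltW.
have := iy; rewrite inE => /andP[y0 y1].
move: ari; rewrite /ratio; case: (ltgtP (v 0 i) 0) vi => // v0 _.
- by rewrite ler_ndivlMr // => h; apply/andP; split; [lra|nra].
- by rewrite ler_pdivlMr // => h; apply/andP; split; [nra|lra].
Qed.

(** Frozen coordinates do not move, so none revives, and the coordinate that hits 0 or 1 is lost. *)
Lemma step_alive y z : step G t y z -> alive z \proper alive y.
Proof.
move=> st; apply/properP; split.
- by apply/subsetP => i; apply: contraTT => iy; move: (iy); rewrite !inE (step_frozen st iy).
- case/stepP: st => v _ [a [_ _ [i iy hit] _]]; exists i => //.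
  by rewrite inE; case: hit => ->; rewrite ltxx ?andbF.
Qed.

Lemma reach_itv x k y : reach G t x k y -> forall i, 0 <= y 0 i <= 1.
Proof.
elim=> [i|k' y' z _ IH st]; last by apply: step_itv st IH.
by have /andP[-> /ltW ->] := frac_part_itv x i.
Qed.

(** Serves the integral entries of [x]: their fractional part 0 survives to the end. *)
Lemma reach_frozen x k y : reach G t x k y ->
  forall i, i \notin alive (frac_part x) -> y 0 i = frac_part x 0 i.
Proof.
elim=> [//|k' y' z _ IH st i ix].
by rewrite (step_frozen st) ?IH //; move: (ix); rewrite !inE IH.
Qed.

(** The number of alive coordinates is a potential that every step lowers by at least one. *)
Lemma reach_alive x k y : reach G t x k y -> (k + #|alive y| <= K)%N.
Proof.
elim=> [|k' y' z _ IH /step_alive/proper_card st].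
- by rewrite add0n; apply: leq_trans (max_card _) _; rewrite card_ord.
- by lia.
Qed.

(* A group keeps its sum as long as it is active; [y'] is the point at which it
   ceases to be so. *)
Definition group_invariant x (g : {set 'I_K}) y : Prop :=
  \sum_(i in g) y 0 i = \sum_(i in g) frac_part x 0 i \/
  exists y', [/\ forall i, 0 <= y' 0 i <= 1,
                 \sum_(i in g) y' 0 i = \sum_(i in g) frac_part x 0 i,
                 (#|g :&: alive y'| <= t)%N
               & forall i, i \notin alive y' -> y 0 i = y' 0 i].

Lemma reach_group x k y g : g \in G -> reach G t x k y -> group_invariant x g y.
Proof.
move=> gG; elim=> [|k' y' z re IH st]; first by left.
case: IH => [eq0|[u [u01 us ut uy]]].
- have [ga|gna] := boolP (g \in active G t y').
    by left; rewrite (step_sum st ga).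
  right; exists y'; split=> //; first exact: reach_itv re.
  + by move: gna; rewrite inE gG /= -leqNgt.
  + by move=> i; apply: step_frozen st.
(* A coordinate frozen at [u] has the same value at [y'], hence is frozen there too, so [u] remains
   a witness. *)
- right; exists u; split=> // i iu.
  by rewrite (step_frozen st) ?uy //; move: (iu); rewrite !inE uy.
Qed.

Lemma group_discrepancy x k y g : (0 < t)%N -> g \in G -> reach G t x k y ->
  alive y = set0 -> `|\sum_(i in g) (y 0 i - frac_part x 0 i)| < t%:R.
Proof.
move=> t0 gG re y0; rewrite big_split /= sumrN.
case: (reach_group gG re) => [->|[u [u01 us ut uy]]].
  by rewrite subrr normr0 ltr0n.
(* Comparing with [u] instead of the fractional parts leaves only the coordinates alive at [u]: the
   others have kept their values. *)
rewrite -us -sumrN -big_split /=.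
rewrite (bigID (mem (alive u))) /= [X in _ + X]big1 ?addr0; last first.
  by move=> i /andP[_ /uy ->]; rewrite subrr.
apply: le_lt_trans (ler_norm_sum _ _ _) _.
rewrite (eq_bigl (mem (g :&: alive u))) => [|i]; last by rewrite !inE.
(* Strict comparison of sums needs a nonempty index set; the empty case falls back on [0 < t]. *)
have [->|[j jg]] := set_0Vmem (g :&: alive u).
  by rewrite big_set0 ltr0n.
apply: lt_le_trans (_ : \sum_(i in g :&: alive u) 1 <= _); last first.
  by rewrite sumr_const ler_nat.
apply: ltr_sum => [|i]; first by apply/hasP; exists j => //; rewrite mem_index_enum.
(* A point strictly inside (0,1) is at distance less than 1 from both ends. *)
rewrite !inE => /andP[_ /andP[u0 u1]].
have /alive0_01 : i \notin alive y by rewrite y0 inE.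
by move/(_ (reach_itv re i)) => [->|->]; rewrite ltr_norml; apply/andP; split; lra.
Qed.

End Walk.

(** * Null vectors by elimination *)

Section NullVector.
Variables (R : realType) (K : nat) (G : {set {set 'I_K}}) (t : nat).
Implicit Types (x y v : 'rV[R]_K) (V : 'M[R]_K) (g L : {set 'I_K}).

(** Double counting of the pairs of an active group and an alive arm in it: at least [t.+1] per
    group, at most [t] per arm. *)
Lemma card_active y : (forall i : 'I_K, #|[set g in G | i \in g]| <= t)%N ->
  alive y != set0 -> (#|active G t y| < #|alive y|)%N.
Proof.
move=> Gt; rewrite -card_gt0 => y0.
have lo : (t.+1 * #|active G t y| <= \sum_(g in active G t y) #|g :&: alive y|)%N.
  rewrite mulnC -sum_nat_const; apply: leq_sum => g.
  by rewrite inE => /andP[].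
have up : (\sum_(g in active G t y) #|g :&: alive y| <= t * #|alive y|)%N.
  under eq_bigr => g _.
    rewrite -sum1_card (eq_bigl (fun i => (i \in alive y) && (i \in g))).
      rewrite big_mkcondr; over.
    by move=> i; rewrite inE andbC.
  rewrite exchange_big /= mulnC -sum_nat_const; apply: leq_sum => i _.
  rewrite -big_mkcondr /= sum1_card; apply: leq_trans (Gt i).
  by apply: subset_leq_card; apply/subsetP => g; rewrite unfold_in !inE => /andP[/andP[-> _] ->].
by move: (leq_trans lo up); nia.
Qed.

Definition group_sum V g (j : 'I_K) : R := \sum_(i in g) V j i.

(** For a nonzero pivot sum the pivot row is subtracted from itself as well and becomes zero. A
    pivot sum of 0 leaves the matrix unchanged, since division by zero gives 0. *)
Definition eliminate V g (p : 'I_K) : 'M[R]_K :=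
  \matrix_(j, i) (V j i - group_sum V g j / group_sum V g p * V p i).

Definition alive_basis y : 'M[R]_K :=
  \matrix_(j, i) ((j \in alive y) && (j == i))%:R.

(* [L] indexes the rows not yet used as pivots; the rows used as pivots are
   zero. The identity block on [L] is what keeps the remaining rows nonzero. *)
Definition null_rows y (gs : seq {set 'I_K}) V : Prop :=
  exists L,
    [/\ forall j l, l \in L -> V j l = (j == l)%:R,
        forall j i, j \notin L -> V j i = 0,
        forall j i, i \notin alive y -> V j i = 0,
        forall g j, g \in gs -> group_sum V g j = 0
      & (#|alive y| <= #|L| + size gs)%N].

Lemma null_rows_basis y : null_rows y [::] (alive_basis y).
Proof.
exists (alive y); split=> [j l ly|j i jy|j i iy||] //=; last by rewrite addn0.
- by rewrite mxE; case: eqVneq => [->|]; rewrite ?ly ?andbF.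
- by rewrite mxE (negbTE jy).
- by rewrite mxE; case: eqVneq iy => [->|]; rewrite ?andbF // => /negbTE->.
Qed.

Lemma group_sum_eliminate V g h p j :
  group_sum (eliminate V g p) h j =
  group_sum V h j - group_sum V g j / group_sum V g p * group_sum V h p.
Proof.
rewrite /group_sum; under eq_bigr do rewrite mxE.
by rewrite big_split /= sumrN -mulr_sumr.
Qed.

Lemma null_rows_eliminate y gs V g p :
  (group_sum V g p = 0 -> forall j, group_sum V g j = 0) ->
  null_rows y gs V -> null_rows y (rcons gs g) (eliminate V g p).
Proof.
move=> piv [L [VL V0 Vy Vgs cL]].
(* With a zero pivot sum all sums already vanish, so no row is used up and [L] is kept. *)
have [sp0|sp] := eqVneq (group_sum V g p) 0.
  have -> : eliminate V g p = V.
    by apply/matrixP => j i; rewrite mxE sp0 invr0 mulr0 mul0r subr0.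
  exists L; split=> // [h j|]; last by rewrite size_rcons; lia.
  by rewrite mem_rcons inE => /orP[/eqP->|/Vgs]; first exact: piv.
(* Rows outside [L] are zero and cannot have a nonzero sum. *)
have pL : p \in L.
  by apply: contraNT sp => /V0 Vp; rewrite /group_sum big1.
exists (L :\ p); split=> [j l|j i|j i iy|h j|].
(* The pivot row is 0 in every column of [L :\ p], so subtracting its multiples leaves these columns
   unchanged. *)
- by rewrite !inE => /andP[lp lL]; rewrite mxE !VL // [p == l]eq_sym (negbTE lp) mulr0 subr0.
- rewrite !inE negb_and negbK mxE => /orP[/eqP->|jL].
    by rewrite divff // mul1r subrr.
  have -> : group_sum V g j = 0 by rewrite /group_sum big1 // => k _; exact: V0.
  by rewrite V0 // !mul0r subr0.
- by rewrite mxE !Vy // mulr0 subr0.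
- rewrite group_sum_eliminate mem_rcons inE => /orP[/eqP->|hgs].
    by rewrite divfK // subrr.
  by rewrite !(Vgs h) // mulr0 subr0.
- by rewrite size_rcons addnS -addSn -add1n -[1%N]/(nat_of_bool true) -pL -cardsD1.
Qed.

(** Each group uses up at most one row, so [L] is not exhausted, and its identity block has 1 on the
    diagonal. Searching the diagonal thus suffices to find a nonzero row. *)
Lemma null_rows_pivot y gs V : null_rows y gs V -> (size gs < #|alive y|)%N ->
  exists q, V q q != 0.
Proof.
move=> [L [VL _ _ _ cL]] lt; have /card_gt0P[q qL] : (0 < #|L|)%N by lia.
by exists q; rewrite VL // eqxx oner_eq0.
Qed.

Lemma null_rows_direction y gs V q :
  null_rows y gs V -> {subset active G t y <= gs} -> V q q != 0 ->
  direction G t y (row q V).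
Proof.
move=> [L [VL V0 Vy Vgs cL]] sub Vq; split.
- by apply: contraNneq Vq => /rowP/(_ q); rewrite !mxE => ->.
- by move=> i iy; rewrite mxE Vy.
- by move=> g /sub gs_g; rewrite -[RHS](Vgs g q gs_g); apply: eq_bigr => i _; rewrite mxE.
Qed.

Lemma pivot_exists (s : 'I_K -> R) (j0 : 'I_K) :
  exists p, s p = 0 -> forall j, s j = 0.
Proof.
have [/existsP[p sp]|/existsPn h] := boolP [exists p, s p != 0].
  by exists p => sp0; rewrite sp0 eqxx in sp.
by exists j0 => _ j; apply/eqP; move: (h j); rewrite negbK.
Qed.

Lemma direction_exists y : (forall i : 'I_K, #|[set g in G | i \in g]| <= t)%N ->
  alive y != set0 -> exists v, direction G t y v.
Proof.
move=> Gt y0; have lt := card_active Gt y0.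
have [j0 _] : exists j0, j0 \in alive y by apply/set0Pn.
have [V nV] : exists V, null_rows y (enum (active G t y)) V.
  elim/last_ind: (enum _) => [|gs g [V nV]].
    by exists (alive_basis y); apply: null_rows_basis.
  have [p piv] := pivot_exists (group_sum V g) j0.
  by exists (eliminate V g p); apply: null_rows_eliminate.
have [|q Vq] := null_rows_pivot nV; first by rewrite -cardE.
exists (row q V); apply: null_rows_direction nV _ Vq => g.
by rewrite mem_enum.
Qed.

End NullVector.

(** * Integrality, rounding to floor or ceiling, and discrepancy of outputs *)

Section Output.
Variables (R : realType) (K : nat) (G : {set {set 'I_K}}) (t : nat).
Implicit Types x y : 'rV[R]_K.

Lemma reach_final01 x k y : reach G t x k y -> alive y = set0 ->
  forall i, y 0 i = 0 \/ y 0 i = 1.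
Proof.
by move=> re y0 i; apply: alive0_01 (reach_itv re i) _; rewrite y0 inE.
Qed.

Lemma reach_output x k y : (forall i, 0 <= x 0 i) -> reach G t x k y ->
  alive y = set0 ->
  exists n : 'I_K -> nat, forall i, (n i)%:R = (Num.floor (x 0 i))%:~R + y 0 i.
Proof.
move=> x0 re y0.
exists (fun i => addn (absz (Num.floor (x 0 i))) (y 0 i == 1)) => i.
have fl : ((absz (Num.floor (x 0 i)))%:R : R) = (Num.floor (x 0 i))%:~R.
  by rewrite pmulrn gez0_abs // floor_ge0.
rewrite natrD fl; case: (reach_final01 re y0 i) => ->; last by rewrite eqxx.
by rewrite eq_sym oner_eq0.
Qed.

Lemma output_floor_ceil x (n : 'I_K -> nat) i : outputs G t x n ->
  (n i)%:Z = Num.floor (x 0 i) \/ (n i)%:Z = Num.ceil (x 0 i).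
Proof.
move=> [k [y [re y0 ny]]].
(* An entry not alive at the start keeps its fractional part, which is below 1 and hence ends as
   0. *)
have [iphi|iphi] := boolP (i \in alive (frac_part x)); last first.
  left; have yi := reach_frozen re iphi.
  have /andP[_] := frac_part_itv x i; rewrite -yi => y1.
  apply/eqP; rewrite -(eqr_int R) -pmulrn ny; case: (reach_final01 re y0 i) y1 => ->.
    by rewrite addr0.
  by rewrite ltxx.
case: (reach_final01 re y0 i) (ny i) => ->.
  by rewrite addr0 => e; left; apply/eqP; rewrite -(eqr_int R); apply/eqP.
(* The fractional part is positive here, so [x 0 i] is not an integer and its ceiling is the floor
   plus 1. *)
move=> e; right; rewrite ceil_floor.
have -> : x 0 i \isn't a Num.int.
  move: iphi; rewrite inE mxE subr_gt0 => /andP[+ _]; apply: contraTN.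
  by move=> /floorK->; rewrite ltxx.
by apply/eqP; rewrite -(eqr_int R) -pmulrn e rmorphD.
Qed.

Lemma output_discrepancy x (n : 'I_K -> nat) g : (0 < t)%N -> outputs G t x n ->
  g \in G -> `|\sum_(i in g) ((n i)%:R - x 0 i)| < t%:R.
Proof.
move=> t0 [k [y [re y0 ny]]] gG.
rewrite (eq_bigr (fun i => y 0 i - frac_part x 0 i)).
  exact: group_discrepancy re y0.
by move=> i _; rewrite ny mxE; ring.
Qed.

End Output.

(** * Loop programs *)

(* Counting loops in register [r] up to the content of register [b], which the
   body must not change: such programs always halt, so they denote functions. *)
Inductive prog : Type :=
| PSkip
| PSetI of nat & iexp
| PSetR of nat & iexp & iexp & rexp
| PSeq of prog & prog
| PIf of bexp & prog & prog
| PFor of nat & nat & prog.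

Fixpoint compile (p : prog) : cmd :=
  match p with
  | PSkip => Skip
  | PSetI r e => SetI r e
  | PSetR a i j e => SetR a i j e
  | PSeq p q => Seq (compile p) (compile q)
  | PIf b p q => If b (compile p) (compile q)
  | PFor r b p =>
      Seq (SetI r (IConst 0))
        (While (BNot (BLeI (IReg b) (IReg r)))
           (Seq (compile p) (SetI r (IAdd (IReg r) (IConst 1)))))
  end.

(** A syntactic over-approximation; together with [mwrites] it gives a frame condition decided by
    computation. *)
Fixpoint iwrites (p : prog) : seq nat :=
  match p with
  | PSkip | PSetR _ _ _ _ => [::]
  | PSetI r _ => [:: r]
  | PSeq p q | PIf _ p q => iwrites p ++ iwrites q
  | PFor r _ p => r :: iwrites p
  end.

Fixpoint mwrites (p : prog) : seq nat :=
  match p with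
  | PSkip | PSetI _ _ => [::]
  | PSetR a _ _ _ => [:: a]
  | PSeq p q | PIf _ p q => mwrites p ++ mwrites q
  | PFor _ _ p => mwrites p
  end.

(* Loop bounds are registers 0 and 1, which hold the dimensions of the input. *)
Fixpoint well_formed (p : prog) : bool :=
  match p with
  | PSkip | PSetI _ _ | PSetR _ _ _ _ => true
  | PSeq p q | PIf _ p q => well_formed p && well_formed q
  | PFor r b p =>
      [&& (b < 2)%N, b != r, b \notin iwrites p, r \notin iwrites p & well_formed p]
  end.

(** The 4 of a loop covers a test and an increment per pass, and the initial assignment and the last
    test. *)
Fixpoint cost_factor (p : prog) : nat :=
  match p with
  | PSkip | PSetI _ _ | PSetR _ _ _ _ => 1
  | PSeq p q | PIf _ p q => (cost_factor p + cost_factor q).+1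
  | PFor _ _ p => (cost_factor p + 4)%N
  end.

Fixpoint loop_depth (p : prog) : nat :=
  match p with
  | PSkip | PSetI _ _ | PSetR _ _ _ _ => 0
  | PSeq p q | PIf _ p q => maxn (loop_depth p) (loop_depth q)
  | PFor _ _ p => (loop_depth p).+1
  end.

(** * Semantics, frame and running time of loop programs *)

Section Run.
Variable R : realType.
Implicit Types (s : state R) (p q : prog).

Definition incr_ireg s r : state R := set_ireg s r (ireg s r + 1).

Fixpoint run p s : state R :=
  match p with
  | PSkip => s
  | PSetI r e => set_ireg s r (ieval s e)
  | PSetR a i j e => set_rmem s a (ieval s i) (ieval s j) (reval s e)
  | PSeq p q => run q (run p s)
  | PIf b p q => if beval s b then run p s else run q s
  | PFor r b p =>
      iter (ireg s b) (fun s' => incr_ireg (run p s') r) (set_ireg s r 0)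
  end.

Definition agree p s s' : Prop :=
  (forall r, r \notin iwrites p -> ireg s' r = ireg s r) /\
  (forall a i j, a \notin mwrites p -> rmem s' a i j = rmem s a i j).

Lemma agree_run p s : agree p s (run p s).
Proof.
elim: p s => [|r e|a i j e|p IHp q IHq|b p IHp q IHq|r b p IHp] s /=.
- by split.
- by split=> [r'|//]; rewrite inE /= => /negbTE->.
- by split=> [//|a' i' j']; rewrite inE /= => /negbTE->.
- have [pi pm] := IHp s; have [qi qm] := IHq (run p s).
  split=> [r'|a' i' j']; rewrite mem_cat negb_or => /andP[? ?].
    by rewrite qi ?pi.
  by rewrite qm ?pm.
- have [pi pm] := IHp s; have [qi qm] := IHq s.
  split=> [r'|a' i' j']; rewrite mem_cat negb_or => /andP[? ?]; case: ifP => _.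
  + exact: pi.
  + exact: qi.
  + exact: pm.
  + exact: qm.
- elim: (ireg s b) => [|n [IHi IHm]] /=.
    by split=> [r'|//]; rewrite inE negb_or /= => /andP[/negbTE->].
  set s' := iter _ _ _ in IHi IHm *; have [pi pm] := IHp s'.
  split=> [r' rr|a' i' j' ha] /=; last by rewrite pm ?IHm.
  move: (rr); rewrite inE negb_or => /andP[/negbTE-> r'p].
  by rewrite pi ?IHi.
Qed.

Lemma run_ireg p s r : r \notin iwrites p -> ireg (run p s) r = ireg s r.
Proof. by case: (agree_run p s) => h _; apply: h. Qed.

Lemma run_rmem p s a i j : a \notin mwrites p -> rmem (run p s) a i j = rmem s a i j.
Proof. by case: (agree_run p s) => _ h; apply: h. Qed.

(** The invariant rule for loops. The body is given the counter value and [agree] with the state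
    before the loop, so [I] need only describe what the loop writes. *)
Lemma run_for_ind (I : nat -> state R -> Prop) r b p s :
  r \notin iwrites p -> b != r ->
  I 0%N (set_ireg s r 0) ->
  (forall k s', (k < ireg s b)%N -> ireg s' r = k -> agree (PFor r b p) s s' ->
     I k s' -> I k.+1 (set_ireg (run p s') r k.+1)) ->
  I (ireg s b) (run (PFor r b p) s).
Proof.
move=> rp br I0 IS /=; set f := fun s' => _.
suff: forall n, (n <= ireg s b)%N ->
    let s' := iter n f (set_ireg s r 0) in
    [/\ ireg s' r = n, agree (PFor r b p) s s' & I n s'].
  by case/(_ _ (leqnn _)).
elim=> [_|n IH nb] /=.
  rewrite eqxx; split=> //; split=> // r'.
  by rewrite inE negb_or /= => /andP[/negbTE->].
have [rn [ai am] In] := IH (ltnW nb); set s' := iter n _ _ in rn ai am In *.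
have rn' : ireg (run p s') r = n by rewrite run_ireg.
rewrite /f /incr_ireg rn' addn1; split; first by rewrite /= eqxx.
- split=> [r' rr|a i j ha] /=; last by rewrite run_rmem ?am.
  move: (rr); rewrite inE negb_or => /andP[/negbTE-> r'p].
  by rewrite run_ireg ?ai.
- by apply: IS => //; split.
Qed.

(** The body's cost is assumed uniform over states with the same registers 0 and 1, since these
    bound the inner loops. *)
Lemma exec_for r b p s (n := ireg s b) (cost : nat) :
  r \notin iwrites p -> b != r -> b \notin iwrites p ->
  (forall s', ireg s' 0 = ireg s 0 -> ireg s' 1 = ireg s 1 ->
     exists2 k, exec (compile p) s' k (run p s') & (k <= cost)%N) ->
  0%N \notin iwrites (PFor r b p) -> 1%N \notin iwrites (PFor r b p) ->
  exists2 k, exec (compile (PFor r b p)) s k (run (PFor r b p) s)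
           & (k <= n * (cost + 2) + 2)%N.
Proof.
move=> rp br bp ex w0 w1 /=; set w := While _ _; set f := fun s' => _.
(* Here [m] is the number of passes still to be made. *)
suff loop m : forall s', (ireg s' r + m)%N = n -> ireg s' b = n ->
    ireg s' 0 = ireg s 0 -> ireg s' 1 = ireg s 1 ->
    exists2 k, exec w s' k (iter m f s') & (k <= m * (cost + 2) + 1)%N.
  have [] := loop n (set_ireg s r 0); rewrite /= ?eqxx ?(negbTE br) //.
  - by move: w0; rewrite inE negb_or => /andP[/negbTE->].
  - by move: w1; rewrite inE negb_or => /andP[/negbTE->].
  move=> k ek lk; exists (1 + k)%N; last by lia.
  by apply: ExecSeq ek; apply: ExecSetI.
elim: m => [|m IH] s' rs bs s0 s1.
  exists 1%N => //; apply: ExecWhileF; rewrite /= negbK; lia.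
have [k ek lk] := ex s' s0 s1.
have r1 : ireg (run p s') r = ireg s' r by rewrite run_ireg.
have [||||k' ek' lk'] := IH (f s').
- by rewrite /f /incr_ireg /= eqxx r1; lia.
- by rewrite /f /incr_ireg /= (negbTE br) run_ireg.
- by move: w0; rewrite inE negb_or /f /incr_ireg /= => /andP[/negbTE-> w0]; rewrite run_ireg.
- by move: w1; rewrite inE negb_or /f /incr_ireg /= => /andP[/negbTE-> w1]; rewrite run_ireg.
exists ((k + 1) + k').+1; last by rewrite mulSn; lia.
rewrite iterSr; apply: ExecWhileT ek'; first by rewrite /=; lia.
by apply: ExecSeq ek _; apply: ExecSetI.
Qed.

(** Registers 0 and 1 are never written, so every loop bound stays at most [N] and each nesting
    level costs one factor [N.+1]. The successor makes powers monotone in the depth even for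
    [N = 0]. *)
Lemma exec_run p (N : nat) s : well_formed p ->
  0%N \notin iwrites p -> 1%N \notin iwrites p ->
  (ireg s 0 <= N)%N -> (ireg s 1 <= N)%N ->
  exists2 k, exec (compile p) s k (run p s)
           & (k <= cost_factor p * N.+1 ^ loop_depth p)%N.
Proof.
elim: p s => [|r e|a i j e|p IHp q IHq|b p IHp q IHq|r b p IHp] s.
- by exists 1%N => //; apply: ExecSkip.
- by exists 1%N => //; apply: ExecSetI.
- by exists 1%N => //; apply: ExecSetR.
- move=> /= /andP[wp wq]; rewrite !mem_cat !negb_or => /andP[p0 q0] /andP[p1 q1] s0 s1.
  have [k ek lk] := IHp s wp p0 p1 s0 s1.
  have [||k' ek' lk'] := IHq (run p s) wq q0 q1; rewrite ?run_ireg //.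
  exists (k + k')%N; first exact: ExecSeq ek ek'.
  have := leq_pexp2l (ltn0Sn N) (leq_maxl (loop_depth p) (loop_depth q)).
  have := leq_pexp2l (ltn0Sn N) (leq_maxr (loop_depth p) (loop_depth q)).
  by nia.
- move=> /= /andP[wp wq]; rewrite !mem_cat !negb_or => /andP[p0 q0] /andP[p1 q1] s0 s1.
  have := leq_pexp2l (ltn0Sn N) (leq_maxl (loop_depth p) (loop_depth q)).
  have := leq_pexp2l (ltn0Sn N) (leq_maxr (loop_depth p) (loop_depth q)).
  have : (0 < N.+1 ^ maxn (loop_depth p) (loop_depth q))%N by rewrite expn_gt0.
  have [k ek lk] := IHp s wp p0 p1 s0 s1.
  have [k' ek' lk'] := IHq s wq q0 q1 s0 s1.
  case: ifPn => bs; first by exists k.+1; [exact: ExecIfT|nia].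
  by exists k'.+1; [exact: ExecIfF|nia].
- move=> /and5P[b2 br bp rp wp] w0 w1 s0 s1.
  have p0 : 0%N \notin iwrites p by apply: contra w0; rewrite inE orbC => ->.
  have p1 : 1%N \notin iwrites p by apply: contra w1; rewrite inE orbC => ->.
  have [s' e0 e1|k ek lk] := exec_for (s := s) rp br bp (cost := cost_factor p * N.+1 ^ loop_depth p) _ w0 w1.
    by apply: IHp; rewrite ?e0 ?e1.
  exists k => //; apply: leq_trans lk _; rewrite [loop_depth (PFor _ _ _)]/= [cost_factor (PFor _ _ _)]/= expnS.
  have : (ireg s b <= N)%N by case: (b) b2 => [|[]].
  have : (0 < N.+1 ^ loop_depth p)%N by rewrite expn_gt0.
  move: (cost_factor p) (N.+1 ^ loop_depth p)%N => c e e0 sbN.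
  apply: (@leq_trans (N * (c * e + 2) + 2)); first by rewrite leq_add2r leq_mul.
  have : (N <= N * e)%N by rewrite leq_pmulr.
  by move: e0; clear; nia.
Qed.

End Run.

(** * The rounding program *)

Definition cell a i j := RCell a (IReg i) (IReg j).
Definition entry0 a i := RCell a (IConst 0) (IReg i).
Definition nonzero e := BNot (BAnd (BLeR e RZero) (BLeR RZero e)).
Definition positive e := BNot (BLeR e RZero).
Definition is_alive i := BAnd (positive (entry0 4 i)) (BNot (BLeR ROne (entry0 4 i))).

(* Register 3 counts the moves; 4, 5 and 6 index groups, rows and columns;
   7 counts alive arms; 8 and 9 hold pivots.  Array 4 holds the current point,
   5 the basis, 6 the group sums of its rows, 7 a copy of the pivot row, 8 the
   step lengths. *)
Definition p_init :=
  PFor 6 0 (PSetR 4 (IConst 0) (IReg 6) (RSub (entry0 1 6) (entry0 2 6))).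

Definition p_basis_row :=
  PFor 6 0 (PIf (BAnd (is_alive 5) (BAnd (BLeI (IReg 5) (IReg 6)) (BLeI (IReg 6) (IReg 5))))
             (PSetR 5 (IReg 5) (IReg 6) ROne) (PSetR 5 (IReg 5) (IReg 6) RZero)).
Definition p_basis := PFor 5 0 p_basis_row.

Definition p_count :=
  PSeq (PSetI 7 (IConst 0))
    (PFor 6 0 (PIf (BAnd (positive (cell 0 4 6)) (is_alive 6))
                 (PSetI 7 (IAdd (IReg 7) (IConst 1))) PSkip)).

Definition p_sum :=
  PSeq (PSetR 6 (IConst 0) (IReg 5) RZero)
    (PFor 6 0 (PSetR 6 (IConst 0) (IReg 5)
       (RAdd (entry0 6 5) (RMul (cell 0 4 6) (cell 5 5 6))))).
Definition p_sums := PFor 5 0 p_sum.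

Definition p_search out b :=
  PSeq (PSetI out (IConst 0)) (PFor 5 0 (PIf b (PSetI out (IReg 5)) PSkip)).
Definition p_pivot := p_search 8 (nonzero (entry0 6 5)).
Definition p_select := p_search 9 (nonzero (cell 5 5 5)).

(** The update runs in place and changes the pivot row on the way, so later rows must read a
    copy. *)
Definition p_copy := PFor 6 0 (PSetR 7 (IConst 0) (IReg 6) (cell 5 8 6)).

Definition p_update_row :=
  PFor 6 0 (PSetR 5 (IReg 5) (IReg 6)
    (RSub (cell 5 5 6) (RMul (RDiv (entry0 6 5) (entry0 6 8)) (entry0 7 6)))).
Definition p_update := PFor 5 0 p_update_row.

Definition p_eliminate := PSeq p_sums (PSeq p_pivot (PSeq p_copy p_update)).

Definition p_group :=
  PSeq p_count (PIf (BNot (BLeI (IReg 7) (IReg 2))) p_eliminate PSkip).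

Definition p_ratios :=
  PFor 6 0 (PIf (BLeR (cell 5 9 6) RZero)
    (PSetR 8 (IConst 0) (IReg 6) (RDiv (RSub RZero (entry0 4 6)) (cell 5 9 6)))
    (PSetR 8 (IConst 0) (IReg 6) (RDiv (RSub ROne (entry0 4 6)) (cell 5 9 6)))).

(** The initial candidate is the selected diagonal position, whose entry is nonzero when some arm is
    alive. *)
Definition p_argmin :=
  PSeq (PSetI 8 (IReg 9))
    (PFor 6 0 (PIf (BAnd (nonzero (cell 5 9 6)) (BNot (BLeR (entry0 8 8) (entry0 8 6))))
                 (PSetI 8 (IReg 6)) PSkip)).

Definition p_move :=
  PFor 6 0 (PSetR 4 (IConst 0) (IReg 6)
    (RAdd (entry0 4 6) (RMul (entry0 8 8) (cell 5 9 6)))).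

Definition p_step :=
  PSeq p_basis (PSeq (PFor 4 1 p_group)
    (PSeq p_select (PSeq p_ratios (PSeq p_argmin p_move)))).

Definition p_output :=
  PFor 6 0 (PSetR 3 (IConst 0) (IReg 6) (RAdd (entry0 2 6) (entry0 4 6))).

(** All [K] rounds are run without an exit test: once nothing is alive, the basis is zero and a
    round leaves the point unchanged. *)
Definition p_rounding := PSeq p_init (PSeq (PFor 3 0 p_step) p_output).

(** * Effect of the program fragments on registers and arrays *)

Section Specifications.
Variable R : realType.
Implicit Types (s : state R) (p q : prog).

Lemma run_seq p q s : run (PSeq p q) s = run q (run p s).
Proof. by []. Qed.

Lemma run_for_map r p s a row (F : nat -> R) : r \notin iwrites p -> 0%N != r ->
  (forall k s', (k < ireg s 0)%N -> ireg s' r = k -> agree (PFor r 0 p) s s' ->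
     rmem s' a row k = rmem s a row k ->
     forall i j, rmem (run p s') a i j =
       if (i == row) && (j == k) then F k else rmem s' a i j) ->
  forall i j, rmem (run (PFor r 0 p) s) a i j =
    if (i == row) && (j < ireg s 0)%N then F j else rmem s a i j.
Proof.
move=> rp r0 body.
apply: (@run_for_ind _ (fun k s' => forall i j, rmem s' a i j =
    if (i == row) && (j < k)%N then F j else rmem s a i j)) => //.
- by move=> i j; rewrite ltn0 andbF.
- move=> k s' kn sk ag Ik i j /=.
  rewrite (body k) // ?Ik ?ltnn ?andbF // ltnS [in RHS]leq_eqVlt.
  by case: (i == row) => //=; case: (eqVneq j k) => [->|].
Qed.

Lemma run_initE s i : (i < ireg s 0)%N ->
  rmem (run p_init s) 4 0 i = rmem s 1 0 i - rmem s 2 0 i.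
Proof.
move=> lti; rewrite /p_init (run_for_map (row := 0) (F := fun i => rmem s 1 0 i - rmem s 2 0 i)) ?lti //.
by move=> k s' _ sk [_ am] _ i' j' /=; rewrite sk (am 1%N) // (am 2%N).
Qed.

Definition alive_at s i := 0 < rmem s 4 0 i < 1.

Lemma is_aliveE s r : beval s (is_alive r) = alive_at s (ireg s r).
Proof. by rewrite /= -!ltNge. Qed.

Lemma nonzeroE s e : beval s (nonzero e) = (reval s e != 0).
Proof. by rewrite /= -eq_le. Qed.

Lemma run_basisE s j i : (j < ireg s 0)%N -> (i < ireg s 0)%N ->
  rmem (run p_basis s) 5 j i = (alive_at s j && (j == i))%:R.
Proof.
rewrite /p_basis => + lti; move: j.
apply: (@run_for_ind _ (fun k s' => forall j, (j < k)%N -> rmem s' 5 j i =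
    (alive_at s j && (j == i))%:R)) => //.
move=> k s' kn sk [ai am] Ik j; rewrite ltnS => jk.
rewrite -[LHS]/(rmem (run p_basis_row s') 5 j i) /p_basis_row.
rewrite (run_for_map (row := k) (F := fun i => (alive_at s k && (k == i))%:R)) //.
  rewrite ai // lti andbT; move: jk; rewrite leq_eqVlt => /orP[/eqP->|jk]; first by rewrite eqxx.
  by rewrite (ltn_eqF jk) Ik.
move=> k' s'' _ sk' [ai' am'] _ i' j'.
have al : beval s'' (BAnd (is_alive 5) (BAnd (BLeI (IReg 5) (IReg 6)) (BLeI (IReg 6) (IReg 5))))
    = alive_at s k && (k == k').
  rewrite -[LHS]/(beval s'' (is_alive 5) && (ireg s'' 5 <= ireg s'' 6 <= ireg s'' 5)%N).
  by rewrite is_aliveE -eqn_leq sk' (ai' 5%N) // sk /alive_at (am' 4%N) // am.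
by rewrite /run al; case: (alive_at s k && _) => /=; rewrite (ai' 5%N) // sk sk'.
Qed.

Lemma run_countE s :
  ireg (run p_count s) 7 =
  (\sum_(0 <= i < ireg s 0) ((0 < rmem s 0 (ireg s 4) i)%R && alive_at s i))%N.
Proof.
rewrite /p_count run_seq; set s0 := run _ s.
apply: (@run_for_ind _ (fun k s' => ireg s' 7 =
    (\sum_(0 <= i < k) ((0 < rmem s 0 (ireg s 4) i)%R && alive_at s i))%N) _ _ _ s0) => //.
  by rewrite big_geq.
move=> k s' kn sk [ai am] Ik.
have cond : beval s' (BAnd (positive (cell 0 4 6)) (is_alive 6)) =
    (0 < rmem s 0 (ireg s 4) k) && alive_at s k.
  rewrite -[LHS]/(~~ (rmem s' 0 (ireg s' 4) (ireg s' 6) <= 0) && beval s' (is_alive 6)).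
  by rewrite is_aliveE -ltNge sk (ai 4%N) // (am 0%N) // /alive_at (am 4%N).
by rewrite /run cond big_nat_recr //= -Ik; case: ifP => _ //=; rewrite addn0.
Qed.

(** Covers every cell of array 6, as the body hypothesis of [run_for_map] requires. *)
Lemma run_sumE s i j :
  rmem (run p_sum s) 6 i j =
  if (i == 0%N) && (j == ireg s 5)
  then \sum_(0 <= i < ireg s 0) rmem s 0 (ireg s 4) i * rmem s 5 (ireg s 5) i
  else rmem s 6 i j.
Proof.
rewrite /p_sum run_seq; set s0 := run _ s.
move: i j; apply: (@run_for_ind _ (fun k s' => forall i j, rmem s' 6 i j =
  if (i == 0%N) && (j == ireg s 5)
  then \sum_(0 <= i < k) rmem s 0 (ireg s 4) i * rmem s 5 (ireg s 5) i
  else rmem s 6 i j) _ _ _ s0) => //.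
  by move=> i j /=; rewrite big_geq.
move=> k s' kn sk [ai am] Ik i j.
rewrite big_nat_recr //= sk (ai 5%N) // (ai 4%N) // (am 5%N) // (am 0%N) // !Ik /= eqxx.
by case: (_ && _).
Qed.

Lemma run_sumsE s j : (j < ireg s 0)%N ->
  rmem (run p_sums s) 6 0 j =
  \sum_(0 <= i < ireg s 0) rmem s 0 (ireg s 4) i * rmem s 5 j i.
Proof.
move=> ltj; rewrite /p_sums (run_for_map (row := 0)
  (F := fun j => \sum_(0 <= i < ireg s 0) rmem s 0 (ireg s 4) i * rmem s 5 j i)) ?ltj //.
move=> k s' _ sk [ai am] _ i' j'; rewrite run_sumE sk (ai 0%N) // (ai 4%N) //.
by under eq_bigr do rewrite (am 0%N) // (am 5%N) //.
Qed.

(** The last hit overwrites earlier ones; without a hit the default 0 remains, which is in range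
    only when register 0 is positive. *)
Lemma run_searchP (out : nat) b s (B : nat -> bool) : out != 5%N -> out != 0%N ->
  (forall k s', ireg s' 5 = k -> agree (p_search out b) s s' -> beval s' b = B k) ->
  let q := ireg (run (p_search out b) s) out in
  ((0 < ireg s 0)%N -> (q < ireg s 0)%N) /\
  (B q \/ forall k, (k < ireg s 0)%N -> ~~ B k).
Proof.
move=> o5 o0 bB; rewrite /p_search run_seq; set s0 := run _ s.
have -> : ireg s 0 = ireg s0 0 by rewrite /= [0%N == _]eq_sym (negbTE o0).
apply: (@run_for_ind _ (fun k s' =>
  ((0 < ireg s0 0)%N -> (ireg s' out < ireg s0 0)%N) /\
  (B (ireg s' out) \/ forall k', (k' < k)%N -> ~~ B k')) _ _ _ s0) => //.
- by rewrite inE eq_sym o5.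
- by rewrite /= (negbTE o5) eqxx; split=> //; right.
move=> k s' kn sk [ai am] [lt0 Bk].
have bk : beval s' b = B k.
  apply: bB => //; split=> [r|a i j]; last exact: am.
  by rewrite !inE !negb_or => /and3P[ro r5 _]; rewrite ai /= ?(negbTE ro) // !inE !negb_or r5.
have -> : run (PIf b (PSetI out (IReg 5)) PSkip) s' =
    if B k then set_ireg s' out k else s' by rewrite /run bk /ieval sk.
rewrite [ireg (set_ireg _ 5 _) _]/= (negbTE o5).
case: ifPn => [Bkk|nBk] /=; first by rewrite eqxx; split=> //; left.
split=> //; case: Bk => [|Bk]; [by left|right] => k'.
by rewrite ltnS leq_eqVlt => /orP[/eqP->|/Bk].
Qed.

Lemma run_pivotP s (p := ireg (run p_pivot s) 8) :
  ((0 < ireg s 0)%N -> (p < ireg s 0)%N) /\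
  (rmem s 6 0 p = 0 -> forall k, (k < ireg s 0)%N -> rmem s 6 0 k = 0).
Proof.
have [|lt0 Bp] := @run_searchP 8 (nonzero (entry0 6 5)) s (fun k => rmem s 6 0 k != 0) isT isT.
  by move=> k s' sk [_ am]; rewrite nonzeroE /= sk am.
split=> //; case: Bp => [/negP np /eqP//|z _ k /z].
by rewrite negbK => /eqP.
Qed.

Lemma run_selectP s (q := ireg (run p_select s) 9) :
  ((0 < ireg s 0)%N -> (q < ireg s 0)%N) /\
  (rmem s 5 q q = 0 -> forall k, (k < ireg s 0)%N -> rmem s 5 k k = 0).
Proof.
have [|lt0 Bp] := @run_searchP 9 (nonzero (cell 5 5 5)) s (fun k => rmem s 5 k k != 0) isT isT.
  by move=> k s' sk [_ am]; rewrite nonzeroE /= sk am.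
split=> //; case: Bp => [/negP np /eqP//|z _ k /z].
by rewrite negbK => /eqP.
Qed.

Lemma run_copyE s i : (i < ireg s 0)%N ->
  rmem (run p_copy s) 7 0 i = rmem s 5 (ireg s 8) i.
Proof.
move=> lti; rewrite /p_copy (run_for_map (row := 0) (F := rmem s 5 (ireg s 8))) ?lti //.
by move=> k s' _ sk [ai am] _ i' j' /=; rewrite sk (ai 8) // am.
Qed.

Lemma run_updateE s j i : (j < ireg s 0)%N -> (i < ireg s 0)%N ->
  rmem (run p_update s) 5 j i =
  rmem s 5 j i - rmem s 6 0 j / rmem s 6 0 (ireg s 8) * rmem s 7 0 i.
Proof.
rewrite /p_update => ltj lti.
set F := fun j i => rmem s 5 j i - rmem s 6 0 j / rmem s 6 0 (ireg s 8) * rmem s 7 0 i.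
suff -> : rmem (run (PFor 5 0 p_update_row) s) 5 j i =
    if (j < ireg s 0)%N then F j i else rmem s 5 j i by rewrite ltj.
move: j {ltj}; apply: (@run_for_ind _ (fun k s' => forall j, rmem s' 5 j i =
    if (j < k)%N then F j i else rmem s 5 j i)) => //.
move=> k s' kn sk [ai am] Ik j.
rewrite -[LHS]/(rmem (run p_update_row s') 5 j i) /p_update_row.
rewrite (run_for_map (row := k) (F := fun i => if (i < ireg s 0)%N then
   rmem s' 5 k i - rmem s 6 0 k / rmem s 6 0 (ireg s 8) * rmem s 7 0 i else 0)) //.
  rewrite (ai 0%N) // lti andbT !Ik ltnS [(j <= k)%N]leq_eqVlt.
  by case: eqVneq => [->|] //=; rewrite ltnn.
move=> k' s'' kn' sk' [ai' am'] own i' j' /=.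
rewrite (ai' 5%N) // sk sk' own (am' 6%N) // (am 6%N) // (ai' 8%N) // (ai 8%N) //.
rewrite (am' 6%N) // (am 6%N) // (am' 7%N) // (am 7%N) //.
by rewrite -(ai 0%N) // kn'.
Qed.

Lemma run_ratiosE s i : (i < ireg s 0)%N ->
  rmem (run p_ratios s) 8 0 i =
  if rmem s 5 (ireg s 9) i <= 0 then - rmem s 4 0 i / rmem s 5 (ireg s 9) i
  else (1 - rmem s 4 0 i) / rmem s 5 (ireg s 9) i.
Proof.
move=> lti; rewrite /p_ratios (run_for_map (row := 0) (F := fun i =>
  if rmem s 5 (ireg s 9) i <= 0 then - rmem s 4 0 i / rmem s 5 (ireg s 9) i
  else (1 - rmem s 4 0 i) / rmem s 5 (ireg s 9) i)) ?lti //.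
move=> k s' _ sk [ai am] _ i' j' /=; rewrite sk (ai 9%N) // (am 5%N) //.
by case: ifP => /= _; rewrite ?sub0r (am 4%N).
Qed.

Lemma run_argminP s (p := ireg (run p_argmin s) 8) (q := ireg s 9) :
  (q < ireg s 0)%N -> rmem s 5 q q != 0 ->
  [/\ (p < ireg s 0)%N, rmem s 5 q p != 0
    & forall i, (i < ireg s 0)%N -> rmem s 5 q i != 0 ->
        rmem s 8 0 p <= rmem s 8 0 i].
Proof.
move=> ltq qq; rewrite {}/p /p_argmin run_seq; set s0 := run _ s.
apply: (@run_for_ind _ (fun k s' =>
  [/\ (ireg s' 8 < ireg s 0)%N, rmem s 5 q (ireg s' 8) != 0
    & forall i, (i < k)%N -> rmem s 5 q i != 0 ->
        rmem s 8 0 (ireg s' 8) <= rmem s 8 0 i]) _ _ _ s0) => //.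
move=> k s' kn sk [ai am] [lt0 nz mn].
have cond : beval s' (BAnd (nonzero (cell 5 9 6)) (BNot (BLeR (entry0 8 8) (entry0 8 6)))) =
    (rmem s 5 q k != 0) && (rmem s 8 0 k < rmem s 8 0 (ireg s' 8)).
  rewrite -[LHS]/(beval s' (nonzero (cell 5 9 6)) && _) nonzeroE /= -ltNge.
  by rewrite sk (ai 9%N) // (am 5%N) // !(am 8%N).
rewrite /run cond; case: ifP => [/andP[nk lk]|/negbT c] /=.
- rewrite sk; split=> // i; rewrite ltnS leq_eqVlt => /orP[/eqP->//|ik] ni.
  exact: le_trans (ltW lk) (mn i ik ni).
- split=> // i; rewrite ltnS leq_eqVlt => /orP[/eqP->|]; last exact: mn.
  by move=> nk; move: c; rewrite nk /= -leNgt.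
Qed.

Lemma run_moveE s i : (i < ireg s 0)%N ->
  rmem (run p_move s) 4 0 i =
  rmem s 4 0 i + rmem s 8 0 (ireg s 8) * rmem s 5 (ireg s 9) i.
Proof.
move=> lti; rewrite /p_move (run_for_map (row := 0) (F := fun i =>
  rmem s 4 0 i + rmem s 8 0 (ireg s 8) * rmem s 5 (ireg s 9) i)) ?lti //.
move=> k s' _ sk [ai am] own i' j' /=.
by rewrite sk own (ai 8%N) // (ai 9%N) // (am 8%N) // (am 5%N).
Qed.

Lemma run_outputE s i : (i < ireg s 0)%N ->
  rmem (run p_output s) 3 0 i = rmem s 2 0 i + rmem s 4 0 i.
Proof.
move=> lti; rewrite /p_output
  (run_for_map (row := 0) (F := fun i => rmem s 2 0 i + rmem s 4 0 i)) ?lti //.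
by move=> k s' _ sk [_ am] _ i' j' /=; rewrite sk (am 2%N) // (am 4%N).
Qed.

End Specifications.

(** * The program carries out the rounding procedure *)

Section Correctness.
Variables (R : realType) (K : nat) (G : {set {set 'I_K}}) (t : nat).
Variable gs : seq {set 'I_K}.
Hypothesis gsG : perm_eq gs (enum G).
Hypothesis Gt : forall i : 'I_K, (#|[set g in G | i \in g]| <= t)%N.
Implicit Types (x y v : 'rV[R]_K) (V : 'M[R]_K) (s : state R).

Definition holds_groups s : Prop :=
  [/\ ireg s 0 = K, ireg s 1 = size gs, ireg s 2 = t
    & forall j (i : 'I_K), rmem s 0 j i = (i \in nth set0 gs j)%:R].

Definition holds_point s y : Prop := forall i : 'I_K, rmem s 4 0 i = y 0 i.

Definition holds_rows s V : Prop := forall j i : 'I_K, rmem s 5 j i = V j i.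

Lemma holds_groups_agree p s s' : agree p s s' ->
  0%N \notin iwrites p -> 1%N \notin iwrites p -> 2%N \notin iwrites p ->
  0%N \notin mwrites p -> holds_groups s -> holds_groups s'.
Proof.
move=> [ai am] p0 p1 p2 m0 [h0 h1 h2 hg]; split=> [||| j i]; rewrite ?ai //.
by rewrite am // hg.
Qed.

Lemma alive_atE s y (i : 'I_K) : holds_point s y -> alive_at s i = (i \in alive y).
Proof. by move=> sy; rewrite /alive_at sy inE. Qed.

Lemma run_basis_rows s y : holds_groups s -> holds_point s y ->
  holds_rows (run p_basis s) (alive_basis y).
Proof.
move=> [h0 _ _ _] sy j i; rewrite run_basisE ?h0 //.
by rewrite (alive_atE j sy) mxE.
Qed.

Lemma run_count_card s y g : holds_groups s -> holds_point s y -> ireg s 4 = g ->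
  ireg (run p_count s) 7 = #|nth set0 gs g :&: alive y|.
Proof.
move=> [h0 _ _ hg] sy sg; rewrite run_countE h0 sg big_mkord -sum1_card.
rewrite [RHS]big_mkcond; apply: eq_bigr => i _ /=.
by rewrite hg (alive_atE i sy) in_setI ltr0n lt0b; case: (_ && _).
Qed.

Lemma run_eliminate_rows s V g : (0 < K)%N -> holds_groups s -> holds_rows s V ->
  ireg s 4 = g ->
  exists2 p : 'I_K,
    group_sum V (nth set0 gs g) p = 0 ->
      forall j, group_sum V (nth set0 gs g) j = 0
    & holds_rows (run p_eliminate s) (eliminate V (nth set0 gs g) p).
Proof.
move=> K0 hs sV sg; set h := nth set0 gs g.
have [h0 _ _ hg] := hs.
rewrite /p_eliminate !run_seq; set s1 := run p_sums s; set s2 := run p_pivot s1.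
set s3 := run p_copy s2.
have s1sum (j : 'I_K) : rmem s1 6 0 j = group_sum V h j.
  rewrite run_sumsE h0 // big_mkord /group_sum [RHS]big_mkcond /=.
  by apply: eq_bigr => i _; rewrite sg hg sV; case: ifP => _; rewrite ?mul1r ?mul0r.
have s10 : ireg s1 0 = K by rewrite run_ireg.
have s20 : ireg s2 0 = K by rewrite run_ireg.
have s30 : ireg s3 0 = K by rewrite run_ireg.
have [ltp zp] := run_pivotP s1; rewrite s10 in ltp zp.
(* [K0] ensures that the register names an arm even if the search failed and returned 0. *)
pose p := Ordinal (ltp K0); exists p => [z j|j i].
  by rewrite -!s1sum in z *; apply: zp.
rewrite run_updateE ?s30 // mxE -!s1sum [ireg s3 8]run_ireg //.
rewrite [rmem s3 7 0 i]run_copyE ?s20 // ![rmem s3 6 _ _]run_rmem // ![rmem s2 6 _ _]run_rmem //.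
rewrite [rmem s3 5 _ _]run_rmem // ![rmem s2 5 _ _]run_rmem // ![rmem s1 5 _ _]run_rmem //.
by rewrite -!sV.
Qed.

Lemma run_group_rows s y V g : (0 < K)%N -> (g < size gs)%N -> holds_groups s ->
  holds_point s y -> ireg s 4 = g -> holds_rows s V ->
  null_rows y [seq h <- take g gs | h \in active G t y] V ->
  exists2 V', holds_rows (run p_group s) V' &
    null_rows y [seq h <- take g.+1 gs | h \in active G t y] V'.
Proof.
move=> K0 ltg hs sy sg sV nV; set h := nth set0 gs g.
have hG : h \in G by rewrite -mem_enum -(perm_mem gsG) mem_nth.
rewrite /p_group run_seq (take_nth set0) // -/h filter_rcons inE hG andTb.
set s1 := run p_count s.
have s1V : holds_rows s1 V by move=> j i; rewrite run_rmem.
have s1s : holds_groups s1 by apply: holds_groups_agree (agree_run p_count s) _ _ _ _ hs.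
have [_ _ s12 _] := s1s.
(* As [h] is in [G], the counter test decides exactly whether [h] is active; an inactive group adds
   nothing to the filtered list. *)
have -> : run (PIf (BNot (BLeI (IReg 7) (IReg 2))) p_eliminate PSkip) s1 =
    if (t < #|h :&: alive y|)%N then run p_eliminate s1 else s1.
  by rewrite /run /beval /ieval s12 (run_count_card hs sy sg) -ltnNge.
case: (t < _)%N; last by exists V.
have [|p piv s2V] := run_eliminate_rows (g := g) K0 s1s s1V; first by rewrite run_ireg.
by exists (eliminate V h p) => //; apply: null_rows_eliminate.
Qed.

Lemma run_groups_rows s y V : (0 < K)%N -> holds_groups s -> holds_point s y ->
  holds_rows s V -> null_rows y [::] V ->
  exists2 V', holds_rows (run (PFor 4 1 p_group) s) V' &
    null_rows y [seq h <- gs | h \in active G t y] V'.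
Proof.
move=> K0 hs sy sV nV; rewrite -[in X in null_rows _ X](take_size gs).
have [_ <- _ _] := hs.
apply: (@run_for_ind _ (fun k s' => exists2 V', holds_rows s' V' &
    null_rows y [seq h <- take k gs | h \in active G t y] V')) => //.
  by exists V; rewrite ?take0.
move=> k s' kn sk ag [V1 s'V1 nV1]; have [ai am] := ag.
have hs' : holds_groups s' by apply: holds_groups_agree ag _ _ _ _ hs.
apply: run_group_rows nV1 => //.
- by have [_ <- _ _] := hs.
- by move=> i; rewrite am.
Qed.

(** The listing has no repetitions, so the eliminations number at most the active groups and the
    count of [card_active] applies. *)
Lemma size_active_gs y :
  size [seq h <- gs | h \in active G t y] = #|active G t y|.
Proof.
rewrite cardE; apply/perm_size/uniq_perm => [||h].
- by rewrite filter_uniq // (perm_uniq gsG) enum_uniq.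
- exact: enum_uniq.
- by rewrite mem_filter (perm_mem gsG) !mem_enum; apply: andb_idr; rewrite inE => /andP[].
Qed.

Lemma run_step_point s y : (0 < K)%N -> holds_groups s -> holds_point s y ->
  exists2 z, holds_point (run p_step s) z &
    (alive y = set0 -> z = y) /\ (alive y != set0 -> step G t y z).
Proof.
move=> K0 hs sy; rewrite /p_step !run_seq.
set s1 := run p_basis s; set s2 := run (PFor 4 1 p_group) s1.
set s3 := run p_select s2; set s4 := run p_ratios s3; set s5 := run p_argmin s4.
have hs1 : holds_groups s1 by apply: holds_groups_agree (agree_run p_basis s) _ _ _ _ hs.
have s1y : holds_point s1 y by move=> i; rewrite run_rmem.
have [V s2V nV] := run_groups_rows K0 hs1 s1y (run_basis_rows hs sy) (null_rows_basis y).
have s20 : ireg s2 0 = K by rewrite run_ireg //; case: hs1.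
have s30 : ireg s3 0 = K by rewrite run_ireg.
have s40 : ireg s4 0 = K by rewrite run_ireg.
have s50 : ireg s5 0 = K by rewrite run_ireg.
have [ltq zq] := run_selectP s2; rewrite s20 in ltq zq.
pose q := Ordinal (ltq K0).
have s39 : ireg s3 9 = q by [].
have s49 : ireg s4 9 = q by rewrite run_ireg.
have s59 : ireg s5 9 = q by rewrite run_ireg.
have s3V : holds_rows s3 V by move=> j i; rewrite run_rmem.
have s4V : holds_rows s4 V by move=> j i; rewrite run_rmem.
have s5V : holds_rows s5 V by move=> j i; rewrite run_rmem.
have s3y : holds_point s3 y by move=> i; do 2! rewrite run_rmem //.
have s5y : holds_point s5 y by move=> i; do 2! rewrite run_rmem //.
have s4r (i : 'I_K) : rmem s4 8 0 i = ratio y (row q V) i.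
  by rewrite run_ratiosE ?s30 // s39 s3V s3y /ratio mxE.
have s5r (i : 'I_K) : rmem s5 8 0 i = ratio y (row q V) i by rewrite run_rmem.
exists (y + rmem s5 8 0 (ireg s5 8) *: row q V).
  by move=> i; rewrite run_moveE ?s50 // s5y s59 s5V !mxE.
(* With nothing alive, every row of [V] vanishes by its support condition, whichever row was
   selected. *)
split=> [y0|y0].
  case: nV => [L [_ _ Vy _ _]]; apply/rowP => i.
  by rewrite !mxE Vy ?mulr0 ?addr0 // y0 inE.
(* Some diagonal entry is nonzero, so a search over all arms cannot have ended on a zero one. *)
have Vq : V q q != 0.
  have [|j] := null_rows_pivot nV; first by rewrite size_active_gs card_active.
  apply: contraNneq => Vq; rewrite -s2V zq //.
  by rewrite -[LHS]/(rmem s2 5 q q) s2V.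
have dir : direction G t y (row q V).
  apply: null_rows_direction nV _ Vq => g ga; rewrite mem_filter ga (perm_mem gsG) mem_enum.
  by move: ga; rewrite inE => /andP[].
(* The program always takes the plus sign, one of the two choices left open by the procedure. *)
exists (row q V) => //; left.
have [||ltp Vp minp] := @run_argminP _ s4; rewrite ?s40 ?s49 //; first by rewrite s4V.
rewrite -/s5 s40 s49 in ltp Vp minp.
pose p := Ordinal ltp; have -> : ireg s5 8 = p by [].
rewrite s5r; have [_ supp _] := dir; apply: move_min_ratio => // [|j].
  by rewrite mxE -s4V.
by rewrite mxE -s4V => Vj; rewrite -!s4r; apply: minp.
Qed.

Lemma run_rounding s x : holds_groups s ->
  (forall i : 'I_K, rmem s 1 0 i = x 0 i) ->
  (forall i : 'I_K, rmem s 2 0 i = (Num.floor (x 0 i))%:~R) ->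
  exists k y, [/\ reach G t x k y, alive y = set0 &
    forall i : 'I_K, rmem (run p_rounding s) 3 0 i = (Num.floor (x 0 i))%:~R + y 0 i].
Proof.
move=> hs sx sfl; rewrite /p_rounding !run_seq.
set s1 := run p_init s; set s2 := run (PFor 3 0 p_step) s1.
have hs1 : holds_groups s1 by apply: holds_groups_agree (agree_run p_init s) _ _ _ _ hs.
have [s0K _ _ _] := hs; have [s1K _ _ _] := hs1.
have s2K : ireg s2 0 = K by rewrite run_ireg.
(* After [m] rounds at most [K - m] arms are alive. The number [k] of actual moves may be smaller
   than [m], because idle rounds are not moves. *)
have [k [y [re s2y aly]]] : exists k y,
    [/\ reach G t x k y, holds_point s2 y & (#|alive y| <= K - ireg s1 0)%N].
  apply: (@run_for_ind _ (fun m s' => exists k y,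
    [/\ reach G t x k y, holds_point s' y & (#|alive y| <= K - m)%N])) => //.
    exists 0%N, (frac_part x); split; first exact: Reach0.
    - by move=> i; rewrite run_initE ?s0K // sx sfl mxE.
    - by rewrite subn0; apply: leq_trans (max_card _) _; rewrite card_ord.
  move=> m s' ltm sm ag [k [y [re sy aly]]]; rewrite s1K in ltm.
  have K0 : (0 < K)%N by apply: leq_ltn_trans ltm.
  have hs' : holds_groups s' by apply: holds_groups_agree ag _ _ _ _ hs1.
  have [z sz [stop go]] := run_step_point K0 hs' sy.
  have [y0|y0] := eqVneq (alive y) set0.
    by exists k, y; split=> //; [rewrite -(stop y0)|rewrite y0 cards0].
  exists k.+1, z; split=> //; first exact: ReachS re (go y0).
  by have := proper_card (step_alive (go y0)); lia.
exists k, y; split=> //.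
  by apply/eqP; rewrite -cards_eq0 -leqn0; move: aly; rewrite s1K subnn.
move=> i; rewrite run_outputE ?s2K // s2y; congr (_ + _).
by rewrite run_rmem // run_rmem.
Qed.

End Correctness.

(** * The guarantees of the procedure and its polynomial running time *)

Theorem theorem6 (R : realType) :
  exists (P : cmd) (c d : nat),
  forall (K : nat) (G : {set {set 'I_K}}) (t : nat) (f : {set 'I_K} -> R)
         (x : 'rV[R]_K) (C : nat),
    (1 <= t)%N ->
    (forall i : 'I_K, (#|[set g in G | i \in g]| <= t)%N) ->
    (forall i : 'I_K, 0 <= x 0 i) ->
    (forall g, g \in G -> f g + t%:R <= \sum_(i in g) x 0 i) ->
    \sum_(i < K) Num.ceil (x 0 i) <= C%:Z ->
    [/\ (* the procedure is never stuck and performs at most K moves *)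
        forall (k : nat) (y : 'rV[R]_K), reach G t x k y ->
          (k <= K)%N /\
          (alive y != set0 ->
             (exists v, direction G t y v) /\
             (forall v, direction G t y v ->
                (exists z, move y v z) /\ (exists z, move y (- v) z))),
        (* when it stops, y is a 0-1 vector and the output is integral *)
        forall (k : nat) (y : 'rV[R]_K), reach G t x k y -> alive y = set0 ->
          (forall i, y 0 i = 0 \/ y 0 i = 1) /\
          (exists n : 'I_K -> nat,
             forall i, (n i)%:R = (Num.floor (x 0 i))%:~R + y 0 i),
        (* guarantees for every possible output *)
        forall n : 'I_K -> nat, outputs G t x n ->
          [/\ forall i, (n i)%:Z = Num.floor (x 0 i) \/
                        (n i)%:Z = Num.ceil (x 0 i),
              [/\ \sum_(i < K) Num.floor (x 0 i) <= \sum_(i < K) (n i)%:Z,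
                  \sum_(i < K) (n i)%:Z <= \sum_(i < K) Num.ceil (x 0 i)
                & \sum_(i < K) Num.ceil (x 0 i) <= C%:Z],
              forall g, g \in G ->
                `| \sum_(i in g) ((n i)%:R - x 0 i) | < t%:R,
              forall g, g \in G -> f g <= \sum_(i in g) (n i)%:R
            & (\sum_(i < K) n i <= C)%N]
      & (* the procedure is carried out in polynomial time *)
        forall gs : seq {set 'I_K}, perm_eq gs (enum G) ->
          exists (k : nat) (s : state R) (n : 'I_K -> nat),
            [/\ exec P (input gs t x) k s,
                (k <= c * (K + #|G|).+1 ^ d)%N,
                result s n
              & outputs G t x n]].
Proof.
exists (compile p_rounding), (cost_factor p_rounding), (loop_depth p_rounding).
move=> K G t f x C t0 Gt x0 floors budget; split.
- move=> k y re; split; first by have := reach_alive re; lia.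
  move=> y0; split; first exact: direction_exists.
  move=> v [v0 supp _]; split; apply: move_exists => //.
    by rewrite oppr_eq0.
  by move=> i /supp; rewrite mxE => ->; rewrite oppr0.
- move=> k y re y0; split; first exact: reach_final01 re y0.
  exact: reach_output x0 re y0.
- move=> n out; have fc i := output_floor_ceil i out.
  have ceil_ge i : (Num.floor (x 0 i) <= Num.ceil (x 0 i))%R.
    by rewrite ceil_floor lerDl; case: (_ \isn't a _).
  have le_ceil : \sum_(i < K) (n i)%:Z <= \sum_(i < K) Num.ceil (x 0 i).
    by apply: ler_sum => i _; case: (fc i) => ->.
  have disc g : g \in G -> `|\sum_(i in g) ((n i)%:R - x 0 i)| < t%:R.
    by apply: output_discrepancy out.
  split=> //.
  + split=> //; apply: ler_sum => i _.
    by case: (fc i) => ->.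
  (* The total drops by less than [t], which is the slack in the hypothesis on group totals. *)
  + move=> g gG; have := disc g gG; rewrite big_split /= sumrN ltr_norml => /andP[+ _].
    by have := floors g gG; lra.
  + have := le_trans le_ceil budget.
    by under eq_bigr do rewrite -natz; rewrite -natr_sum natz lez_nat.
- move=> gs gsG; set s := input gs t x.
  have sG : holds_groups t gs s by split=> // j i; rewrite /= /entry valK.
  have sx (i : 'I_K) : rmem s 1 0 i = x 0 i by rewrite /= /entry valK.
  have sfl (i : 'I_K) : rmem s 2 0 i = (Num.floor (x 0 i))%:~R.
    by rewrite /= /entry valK.
  have [k [y [re y0 out]]] := run_rounding gsG Gt sG sx sfl.
  have [n ny] := reach_output x0 re y0.
  have szG : size gs = #|G| by rewrite (perm_size gsG) cardE.
  have [||l ex lel] := @exec_run _ p_rounding (K + #|G|) s isT isT isT.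
  + exact: leq_addr.
  + by rewrite /= szG leq_addl.
  exists l, (run p_rounding s), n; split=> //; last by exists k, y.
  by move=> i; rewrite out ny.
Qed.
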